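(* Let $\Delta$ be a fixed constant, and for each $n$ let $H=H(n,\Delta)$ be a connected graph with $n$ vertices and maximum degree at most $\Delta$. Let $k=k(n)\to\infty$ as $n\to\infty$, and let $R=R(n,k)$ be a random graph on $V(H)$ consisting of exactly $k$ edges chosen uniformly at random from $\binom{V(H)}{2}$. Let $G=H\cup R$. Then with high probability $$g(G)=\Theta\left(\max\{g(H),k\}\right).$$
   Context: $g(\cdot)$ denotes the genus of a graph (minimum number of handles attached to a sphere needed to embed the graph without crossings). ''With high probability'' (whp) means with probability tending to $1$ as $n\to\infty$. For a random variable $a(n)$ and non-negative function $b(n)$, ''$a(n)=\Theta(b(n))$ whp'' means there exist constants $c>0$ and $C$ such that $c\,b(n)\le a(n)\le C\,b(n)$ whp. *)

(* Defs.v *)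
From HB Require Import structures.
From mathcomp Require Import all_boot all_order all_fingroup all_algebra.
From mathcomp Require Import all_classical all_reals topology normedtype.
From mathcomp Require Import zify.

Set Implicit Arguments.
Unset Strict Implicit.
Unset Printing Implicit Defensive.

Import Order.TTheory GRing.Theory Num.Theory.
Import numFieldNormedType.Exports.
Local Open Scope classical_set_scope.
Local Open Scope ring_scope.

(** * Finite simple graphs *)

(** A simple graph on the vertex set [V] is given by its set of edges, each edge
    being a set of two vertices. *)
Section Graphs.
Variable V : finType.
Implicit Types E : {set {set V}}.

Definition vpairs : {set {set V}} := [set e : {set V} | #|e| == 2%N].

Definition simple_graph E : bool := E \subset vpairs.

Definition adj E : rel V := [rel u v | (u != v) && ([set u; v]%SET \in E)].

Definition connected_graph E : Prop := forall u v, connect (adj E) u v.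

Definition max_degree E : nat := (\max_(v : V) #|adj E v|)%N.

End Graphs.

(** * Closed orientable surfaces and the genus of a graph *)

(** A connected closed oriented surface, presented by a cell decomposition, i.e.
    as oriented polygons glued along pairs of sides.  A dart is a 1-cell with a
    direction and sits at its origin; [sedge] reverses darts and [snode] rotates
    the darts around their common origin, following the orientation.  The
    0-cells, 1-cells and 2-cells are the orbits of [snode], [sedge] and
    [sface]. *)
Record surface := Surface {
  dart : finType;
  sedge : {perm dart};
  snode : {perm dart};
  sedgeK : involutive sedge;
  sedge_neq : forall d, sedge d != d;
  dart_gt0 : (0 < #|dart|)%N;
  surface_connected :
    forall x y, connect [rel d d' | (d' == sedge d) || (d' == snode d)] x y }.

Definition sface (S : surface) : {perm dart S} := (sedge S * snode S)%g.

(** [S] is a sphere with [h] handles attached iff its Euler characteristic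
    (0-cells minus 1-cells plus 2-cells) is [2 - 2h]. *)
Definition has_handles (S : surface) (h : nat) : Prop :=
  #|porbits (snode S)|%:Z - #|porbits (sedge S)|%:Z + #|porbits (sface S)|%:Z
    = 2%:Z - 2%:Z * h%:Z.

(** A drawing of [(V, E)] without crossings on [S]: vertices are sent to distinct
    0-cells (the vertex [v] to the origin of the dart [phi v]) and every edge to
    a 1-cell joining the images of its ends; as [(V, E)] is simple, distinct
    edges go to distinct 1-cells.  The decomposition may have further cells, so
    the regions cut out by the drawing itself need not be discs, and [(V, E)]
    need not be connected. *)
Definition drawing (V : finType) (E : {set {set V}}) (S : surface)
    (phi : V -> dart S) : Prop :=
  (forall u v, phi u \in porbit (snode S) (phi v) -> u = v) /\
  (forall u v, adj E u v -> exists d : dart S,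
     d \in porbit (snode S) (phi u) /\ sedge S d \in porbit (snode S) (phi v)).

Definition embeddable (V : finType) (E : {set {set V}}) (h : nat) : Prop :=
  exists S : surface, has_handles S h /\ exists phi : V -> dart S, drawing E phi.

(** Every graph embeds in some surface: on a surface whose 1-skeleton is a
    complete graph with [m] vertices, [m] odd, with loops and every edge
    doubled, the rotations can be chosen so that all faces are long. *)
Section Exists.
Variable p : nat.
Let m := p.*2.+3.
Let D : finType := ('I_m * 'I_m * bool)%type.

Let ef (d : D) : D := (d.1.2, d.1.1, ~~ d.2).
Let nf (d : D) : D := (d.1.1, d.1.2 + 1, ~~ d.2).

Fact ef_inj : injective ef.
Proof. by move=> [[a b] c] [[a' b'] c'] [-> -> /negb_inj ->]. Qed.

Fact nf_inj : injective nf.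
Proof.
move=> [[a b] c] [[a' b'] c'] /eqP; rewrite /nf /= !xpair_eqE.
by rewrite (inj_eq (addIr _)) (inj_eq negb_inj) => /andP[/andP[]] /= /eqP-> /eqP-> /eqP->.
Qed.

Let e := perm ef_inj.
Let n := perm nf_inj.

Fact e_inv : involutive e.
Proof. by move=> [[a b] c]; rewrite !permE /ef /= negbK. Qed.

Fact e_neq d : e d != d.
Proof.
case: d => [[a b] c]; rewrite permE /ef /= xpair_eqE /=.
by case: c; rewrite andbF.
Qed.

Fact D_gt0 : (0 < #|D|)%N.
Proof. by apply/card_gt0P; exists (0, 0, false). Qed.

Fact n_iter i (d : D) : (n ^+ i)%g d = (d.1.1, d.1.2 + i%:R, d.2 (+) odd i).
Proof.
elim: i => [|i IH]; first by rewrite expg0 perm1 addr0 addbF; case: d => -[].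
by rewrite expgSr permM IH permE /nf /= -addrA natr1 addbN.
Qed.

Fact m_nat0 : m%:R = 0 :> 'I_m.
Proof. by apply/val_inj; rewrite Zp_nat /= modnn. Qed.

Fact n_orbit (d d' : D) : (d' \in porbit n d) = (d'.1.1 == d.1.1).
Proof.
apply/porbitP/eqP => [[i ->]|]; first by rewrite n_iter.
case: d d' => [[a b] c] [[a' b'] c'] /= ->.
pose j : nat := (b' - b)%R.
have Hj : j%:R = b' - b by rewrite natr_Zp.
have [ej|nj] := eqVneq (c (+) odd j) c'.
  by exists j; rewrite n_iter /= Hj ej addrCA subrr addr0.
exists (j + m)%N; rewrite n_iter /= natrD Hj m_nat0 addr0 addrCA subrr addr0.
congr (_, _, _); rewrite oddD /= odd_double addbT addbN.
by move: nj; case: (c (+) _); case: c'.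
Qed.

Fact D_connected (x y : D) :
  connect [rel d d' : D | (d' == e d) || (d' == n d)] x y.
Proof.
set r := [rel d d' : D | _].
have node (d d' : D) : d'.1.1 = d.1.1 -> connect r d d'.
  move=> /eqP; rewrite -n_orbit => /porbitP[i ->]; elim: i => [|i IH].
    by rewrite expg0 perm1.
  apply: connect_trans IH (connect1 _).
  by rewrite /= expgSr permM eqxx orbT.
apply: connect_trans (node x (x.1.1, y.1.1, false) erefl) _.
apply: connect_trans (node (y.1.1, x.1.1, true) y erefl).
by apply: connect1; rewrite /= permE eqxx.
Qed.

Definition long_faces_surface : surface := Surface e_inv e_neq D_gt0 D_connected.

Fact f_iter2 i (d : D) :
  ((e * n) ^+ i.*2)%g d = (d.1.1 + i%:R, d.1.2 + i%:R, d.2).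
Proof.
elim: i => [|i IH]; first by rewrite expg0 perm1 !addr0; case: d => -[].
rewrite doubleS !expgSr !permM IH !permE /nf /ef /= !negbK.
by rewrite -!addrA !natr1.
Qed.

Fact sum_porbits (s : {perm D}) : (\sum_(A in porbits s) #|A| = #|D|)%N.
Proof.
rewrite -cardsT; apply/esym/card_partition.
apply/and3P; split.
- rewrite finset.eqEsubset finset.subsetT /=.
  apply/fintype.subsetP => x _; apply/bigcupP.
  by exists (porbit s x); rewrite ?imset_f ?porbit_id.
- apply/finset.trivIsetP => _ _ /imsetP[x _ ->] /imsetP[y _ ->] nxy.
  apply/pred0P => z /=; apply/negbTE/negP => /andP[zx zy].
  by move: nxy; rewrite -(eqP (_ : porbit s z == porbit s x)) ?eq_porbit_mem
    ?zx // zy.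
- by apply/negP => /imsetP[x _ /setP/(_ x)]; rewrite porbit_id inE.
Qed.

Fact porbits_bound (s : {perm D}) k :
  (forall x, k <= #|porbit s x|)%N -> (#|porbits s| * k <= #|D|)%N.
Proof.
move=> sk; rewrite -(sum_porbits s) -sum_nat_const.
by apply: leq_sum => _ /imsetP[x _ ->].
Qed.

Fact f_orbit x : (3 <= #|porbit (e * n)%g x|)%N.
Proof.
pose g (i : 'I_m) : D := (x.1.1 + i, x.1.2 + i, x.2).
have g_inj : injective g by move=> i j /eqP; rewrite !xpair_eqE (inj_eq (addrI _)) => /andP[/andP[/eqP]].
apply: (@leq_trans #|g @: 'I_m|).
  by rewrite card_imset // card_ord /m.
apply/subset_leq_card/fintype.subsetP => _ /imsetP[i _ ->].
by rewrite /g -{1 2}(natr_Zp i) -f_iter2 mem_porbit.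
Qed.

Fact e_orbit x : #|porbit e x| = 2%N.
Proof.
have -> : porbit e x = [set x; e x]%SET.
  apply/setP => y; rewrite !inE; apply/porbitP/orP => [[i ->]|].
    elim: i => [|i [/eqP IH|/eqP IH]].
    - by left; rewrite expg0 perm1.
    - by right; rewrite expgSr permM IH.
    - by left; rewrite expgSr permM IH e_inv.
  by case=> /eqP->; [exists 0%N; rewrite expg0 perm1 | exists 1%N; rewrite expg1].
by rewrite cards2 eq_sym e_neq.
Qed.

Fact card_e : (#|porbits e| * 2 = #|D|)%N.
Proof.
rewrite -(sum_porbits e) -sum_nat_const.
by apply: eq_bigr => _ /imsetP[x _ ->]; rewrite e_orbit.
Qed.

Fact card_n : (#|porbits n| <= m)%N.
Proof.
have cD : #|D| = (m * m * 2)%N by rewrite !card_prod !card_ord card_bool.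
have : (#|porbits n| * (m * 2) <= #|D|)%N.
  apply: porbits_bound => x.
  pose g (z : 'I_m * bool) : D := (x.1.1, z.1, z.2).
  have g_inj : injective g by move=> [a b] [a' b'] [-> ->].
  apply: (@leq_trans #|g @: [set: 'I_m * bool]%SET|).
    by rewrite card_imset // cardsT card_prod card_ord card_bool.
  by apply/subset_leq_card/fintype.subsetP => _ /imsetP[i _ ->]; rewrite n_orbit.
by rewrite cD -mulnA leq_mul2r.
Qed.

Lemma long_faces_handles : exists h, has_handles long_faces_surface h.
Proof.
have cD : #|D| = (m * m * 2)%N by rewrite !card_prod !card_ord card_bool.
have [He Hn] := (card_e, card_n); have Hf := porbits_bound f_orbit.
have odd_ne : ~~ odd (#|porbits n| + #|porbits e| + #|porbits (e * n)%g|).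
  have := odd_permM e n; rewrite /odd_perm cD muln2 odd_double /= => En.
  by rewrite !oddD En addbC -addbA addbCA addbA addbb; case: odd.
rewrite /has_handles /sface /=.
move: odd_ne He Hn Hf; rewrite cD.
move: #|porbits n| #|porbits e| #|porbits (e * n)%g| => v a f od He Hn Hf.
have lef : (v + f <= a + 2)%N by nia.
exists ((a + 2 - (v + f))./2)%N; lia.
Qed.

End Exists.

Lemma embeddable_exists (V : finType) (E : {set {set V}}) :
  exists h, `[< embeddable E h >].
Proof.
have [h Hh] := long_faces_handles #|V|; exists h; apply/asboolP.
exists (long_faces_surface #|V|); split=> //.
pose q (v : V) : 'I_(#|V|.*2.+3) := inord (enum_rank v).
have qE v : q v = enum_rank v :> nat.
  rewrite inordK //; apply: leq_trans (ltn_ord (enum_rank v)) _.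
  by rewrite -addnn -addn3 -addnA leq_addr.
have q_inj : injective q.
  by move=> u v /(congr1 val); rewrite /= !qE => /ord_inj/enum_rank_inj.
exists (fun v => (q v, 0, false)); split=> [u v|u v _].
  by rewrite n_orbit /= => /eqP/q_inj.
exists (q u, q v, false); rewrite n_orbit eqxx; split=> //.
by rewrite n_orbit permE /= eqxx.
Qed.

Definition genus (V : finType) (E : {set {set V}}) : nat :=
  ex_minn (embeddable_exists E).

(** * Random edge sets and asymptotics *)

Definition k_edge_sets (V : finType) (k : nat) : {set {set {set V}}} :=
  [set E : {set {set V}} | (E \subset vpairs V) && (#|E| == k)].

Definition unif_prob (R : realType) (T : finType) (A : {set T}) (P : pred T) : R :=
  #|[set x in A | P x]|%:R / #|A|%:R.

Definition whp (R : realType) (T : nat -> finType) (A : forall n, {set T n})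
    (P : forall n, pred (T n)) : Prop :=
  unif_prob R (A n) (P n) @[n --> \oo] --> (1 : R).

(** For each [n], [a n] is a random variable on [A n] with the uniform
    distribution. *)
Definition Theta_whp (R : realType) (T : nat -> finType)
    (A : forall n, {set T n}) (a : forall n, T n -> nat) (b : nat -> nat) : Prop :=
  exists c C : R, 0 < c /\
    whp R A (fun n x => c * (b n)%:R <= (a n x)%:R <= C * (b n)%:R).

(* Main.v *)
Require Import Defs.
From mathcomp Require Import all_boot all_fingroup.
From mathcomp Require Import zify.

Set Implicit Arguments.
Unset Strict Implicit.
Unset Printing Implicit Defensive.

(** The upper bound holds for every edge set: a new edge needs at most one more
    handle.  For the lower bound by [k], cut [H] into at most [k / 48] connected
    parts of [O(n / k)] vertices (into singletons if [k > 48 n]).  Contracting the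
    parts does not increase the genus, and the expected numbers of random edges
    inside a part and of pairs of random edges joining the same two parts are
    [O(1)]; so by Markov's inequality the quotient is, with high probability, a
    graph on at most [k / 48] vertices with at least [k / 2] edges between
    distinct pairs of vertices, and Euler's formula makes its genus at least
    linear in [k].  On cell decompositions, contraction multiplies [sedge] and
    [snode] by the same transposition, which fixes their product, and deletion
    multiplies [sedge] alone; neither decreases the number of orbits of the
    three permutations. *)

(** * Orbits of permutations *)

Lemma porbit_closed (D : finType) (s : {perm D}) (P : pred D) x :
  P x -> (forall y, P y -> P (s y)) -> forall y, y \in porbit s x -> P y.
Proof.
move=> Px Ps y /porbitP[i ->]; elim: i => [|i IH]; first by rewrite expg0 perm1.
by rewrite expgSr permM; apply: Ps.
Qed.

Lemma porbit_step (D : finType) (s : {perm D}) x y :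
  y \in porbit s x -> s y \in porbit s x.
Proof.
by move=> /porbitP[i ->]; rewrite -permM -expgSr mem_porbit.
Qed.

Lemma porbit_invariant (D : finType) (T : Type) (s : {perm D}) (g : D -> T) :
  (forall d, g (s d) = g d) -> forall x y, y \in porbit s x -> g y = g x.
Proof.
move=> gs x y /porbitP[i ->]; elim: i => [|i IH]; first by rewrite expg0 perm1.
by rewrite expgSr permM gs.
Qed.

Lemma sum_card_porbits (D : finType) (s : {perm D}) (M : {set D}) :
  \sum_(A in porbits s) #|A :&: M| = #|M|.
Proof.
rewrite -[RHS]sum1_card (partition_big (porbit s) (mem (porbits s))) /=; last first.
  by move=> x _; apply: imset_f.
apply: eq_bigr => _ /imsetP[x _ ->]; rewrite sum1dep_card.
by apply: eq_card => y; rewrite !inE eq_porbit_mem andbC.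
Qed.

(** Every orbit is a swapped pair or one fixed point, so its size plus its number of fixed points is
    2; the identity sums this over all orbits. *)
Lemma card_porbits_involution (D : finType) (e : {perm D}) :
  involutive e -> 2 * #|porbits e| + #|[set d | e d != d]| = 2 * #|D|.
Proof.
move=> eK.
have eO x : porbit e x = [set x; e x].
  apply/setP => y; rewrite !inE; apply/idP/idP; last first.
    by case/orP=> /eqP->; rewrite ?porbit_id // porbit_step // porbit_id.
  apply: (porbit_closed (P := fun z => (z == x) || (z == e x))); rewrite ?eqxx //.
  by move=> z /orP[]/eqP->; rewrite ?eK eqxx ?orbT.
have -> : 2 * #|porbits e| = \sum_(A in porbits e) (#|A :&: setT| + #|A :&: [set d | e d == d]|).
  rewrite mulnC -sum_nat_const; apply: eq_bigr => _ /imsetP[x _ ->].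
  rewrite eO setIT cards2 eq_sym; case: eqP => [ex|/eqP ex] /=.
    rewrite ex finset.setUid.
    have -> : [set x] :&: [set d | e d == d] = [set x].
      by apply/setP=> y; rewrite !inE; case: eqP => // ->; rewrite ex eqxx.
    by rewrite cards1.
  suff -> : [set x; e x] :&: [set d | e d == d] = set0 by rewrite cards0.
  apply/setP => y; rewrite !inE; apply/negP => /andP[/orP[]/eqP-> /eqP].
    by move=> xx; rewrite xx eqxx in ex.
  by rewrite eK => xx; rewrite -xx eqxx in ex.
rewrite big_split /= !sum_card_porbits cardsT -addnA mul2n -addnn; congr (_ + _).
rewrite -(cardsC [set d | e d == d]); congr (_ + _).
by apply: eq_card => d; rewrite !inE.
Qed.

Lemma card_porbits_merge (D : finType) (s : {perm D}) x y :
  x \notin porbit s y -> #|porbits (tperm x y * s)| + 1 = #|porbits s|.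
Proof.
move=> xy; have := porbits_mul_tperm s x y; rewrite /= xy.
have -> : x != y by apply: contraNneq xy => ->; rewrite porbit_id.
lia.
Qed.

(** If [x] were still outside the orbit of [y], multiplying by the transposition again would lower
    the number of orbits once more, yet it gives back [s]. *)
Lemma porbit_merge (D : finType) (s : {perm D}) x y :
  x \notin porbit s y -> x \in porbit (tperm x y * s) y.
Proof.
move=> xy; have := card_porbits_merge xy.
have := porbits_mul_tperm (tperm x y * s) x y; rewrite /= mulgA tperm2 mul1g.
by case: (x \in _) => //=; case: eqP; lia.
Qed.

(** After the merge [x] and [y] share an orbit, so [g] agrees on them; it then does not see the
    transposition and is invariant under [s] itself. *)
Lemma merge_invariant (D : finType) (T : Type) (s : {perm D}) (g : D -> T) x y :
  x \notin porbit s y -> (forall d, g ((tperm x y * s)%g d) = g d) ->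
  g x = g y /\ forall d, g (s d) = g d.
Proof.
move=> xy gs; have gxy : g x = g y.
  by apply: (porbit_invariant gs); apply: porbit_merge.
split=> // d; have := gs (tperm x y d); rewrite permM tpermK => ->.
by case: tpermP => // ->.
Qed.

Lemma card_porbits_tperm_ge (D : finType) (s : {perm D}) x y :
  #|porbits s| <= #|porbits (tperm x y * s)| + 1.
Proof.
have := porbits_mul_tperm (tperm x y * s) x y; rewrite /= mulgA tperm2 mul1g.
by case: (x \in _) => //=; case: eqP; lia.
Qed.

Lemma card_porbits_split (D : finType) (e : {perm D}) d :
  e d != d -> #|porbits (tperm d (e d) * e)| = #|porbits e| + 1.
Proof.
move=> ed; have := porbits_mul_tperm e d (e d); rewrite /= porbit_sym.
by rewrite porbit_step ?porbit_id // [d == _]eq_sym ed; lia.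
Qed.

(** * Face counting *)

Section Faces.
Variables (D T : finType) (e n : {perm D}) (lab : D -> T).
Hypothesis eK : involutive e.
Hypothesis lab_n : forall d, lab (n d) = lab d.
Hypothesis lab_e : forall d, e d != d -> lab (e d) != lab d.
Hypothesis lab_simple : forall d d', e d != d -> e d' != d' ->
  lab d = lab d' -> lab (e d) = lab (e d') -> d = d'.

Let f := (e * n)%g.
(** Fixed points of [e] stand for the darts of deleted edges; [M] holds the darts of the edges that
    remain. *)
Let M := [set d | e d != d].

(** After crossing [d] the face keeps the label of [e d] while it meets fixed points of [e]. It must
    then meet a dart of [M], or it would return to [d] with the wrong label. *)
Fact face_next x d : d \in porbit f x :&: M ->
  exists2 d1, d1 \in porbit f x :&: M & lab d1 = lab (e d).
Proof.
rewrite inE => /andP[dO dM].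
case: (pickP [pred d1 | (d1 \in porbit f x :&: M) && (lab d1 == lab (e d))]).
  by move=> d1 /= /andP[? /eqP ?]; exists d1.
move=> none.
pose P y := (y \in porbit f x) && (lab y == lab (e d)).
have : P d.
  apply: (@porbit_closed _ f P (f d)).
  - by rewrite /P porbit_step // permM lab_n eqxx.
  - move=> y /andP[yO ly]; rewrite /P porbit_step //= permM lab_n.
    have := none y; rewrite /= !inE yO ly andbT /= => /negbFE/eqP ->; exact: ly.
  - by rewrite porbit_sym porbit_step ?porbit_id.
by move=> /andP[_ /eqP le]; move: dM; rewrite inE => /lab_e; rewrite le eqxx.
Qed.

(** With no dart of [M] the face is itself a vertex. A single one is excluded by [lab_e], and two
    are the ends of one edge by [lab_simple]; the face then contains the whole vertex at [e d]. *)
Fact small_face x : #|porbit f x :&: M| <= 2 ->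
  exists y, porbit n y \subset porbit f x.
Proof.
move=> small; have [O0|[d dO]] := set_0Vmem (porbit f x :&: M).
  exists x; apply/subsetP; apply: porbit_closed; first exact: porbit_id.
  move=> y yO; have := porbit_step yO; rewrite permM.
  by have /setP/(_ y) := O0; rewrite !inE yO => /negbFE/eqP->.
have [d1 d1O l1] := face_next dO; have [d2 d2O l2] := face_next d1O.
have mv d' : d' \in porbit f x :&: M -> e d' != d' by rewrite !inE => /andP[].
have d1d : d1 != d by apply: contraTneq (lab_e (mv _ dO)) => E; rewrite -l1 E eqxx.
have d2d1 : d2 != d1 by apply: contraTneq (lab_e (mv _ d1O)) => E; rewrite -l2 E eqxx.
have OM : [set d; d1] = porbit f x :&: M.
  apply/eqP; rewrite eqEcard cards2 [d == _]eq_sym d1d small andbT.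
  by apply/subsetP => y /set2P[]->.
have d2E : d2 = d by move: d2O; rewrite -OM !inE (negbTE d2d1) orbF => /eqP.
have d1E : d1 = e d.
  apply: lab_simple; rewrite ?eK ?mv //; last by rewrite -l2 d2E.
  by rewrite eq_sym mv.
exists (e d); apply/subsetP => y yn.
pose P y := (y \in porbit f x) && (lab y == lab (e d)).
suff /andP[] : P y by [].
move: y yn; apply: porbit_closed.
  by rewrite /P eqxx andbT -d1E; move: d1O; rewrite inE => /andP[].
move=> y /andP[yO ly]; rewrite /P lab_n ly andbT.
have [->|yd] := eqVneq y (e d).
  have := @porbit_step _ f x d; rewrite permM; apply.
  by move: dO; rewrite inE => /andP[].
have := porbit_step yO; rewrite permM.
suff /eqP -> : e y == y by [].
apply/negPn/negP => my.
have : y \in [set d; d1] by rewrite OM !inE yO my.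
rewrite !inE d1E (negbTE yd) orbF => /eqP yd'.
by have := lab_e (mv _ dO); rewrite -(eqP ly) yd' eqxx.
Qed.

(** Faces with at least three darts of [M] are paid for by those darts; each other face contains a
    whole vertex, and distinct faces contain distinct ones. *)
Lemma card_faces : 3 * #|porbits f| <= 3 * #|porbits n| + #|M|.
Proof.
pose small := [set A in porbits f | #|A :&: M| <= 2].
pose h (A : {set D}) : {set D} := odflt set0 [pick B in porbits n | B \subset A].
have hP A : A \in small -> (h A \in porbits n) /\ (h A \subset A).
  rewrite inE => /andP[/imsetP[x _ ->] /small_face[y yx]].
  rewrite /h; case: pickP => [B /andP[]//|/(_ (porbit n y))].
  by rewrite yx imset_f.
have small_le : #|small| <= #|porbits n|.
  rewrite -(card_in_imset (f := h) (D := mem small)).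
    by apply/subset_leq_card/subsetP => _ /imsetP[A /hP[? _] ->].
  move=> A B As Bs hAB; have [/imsetP[x _ hx] hA] := hP A As.
  have [_ hB] := hP B Bs.
  have xA : x \in A by apply: (subsetP hA); rewrite hx porbit_id.
  have xB : x \in B by apply: (subsetP hB); rewrite -hAB hx porbit_id.
  move: As Bs xA xB; rewrite !inE => /andP[/imsetP[a _ ->] _] /andP[/imsetP[b _ ->] _].
  by rewrite -!eq_porbit_mem => /eqP<- /eqP<-.
rewrite -(sum_card_porbits f M) mulnC -sum_nat_const.
apply: (@leq_trans (\sum_(A in porbits f) (3 * (#|A :&: M| <= 2) + #|A :&: M|))).
  by apply: leq_sum => A _; case: leqP; lia.
rewrite big_split /= leq_add2r -big_distrr /= leq_mul2l /=.
apply: leq_trans small_le; rewrite -big_mkcondr /= sum1dep_card.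
by apply: subset_leq_card; apply/subsetP => A; rewrite !inE.
Qed.

Lemma card_labels : #|M| = #|[set (lab d, lab (e d)) | d in M]|.
Proof.
rewrite card_in_imset // => d d'; rewrite !inE => md md' [] l1 l2.
exact: lab_simple.
Qed.

End Faces.

(** * Deleting and contracting edges *)

Section Minors.
Variables (D T : finType).
Implicit Types (e n : {perm D}) (lab : D -> T) (d : D).

(** When [m] edges remain, the involution [e] has [#|D| - m] orbits, so this is the Euler
    characteristic shifted by the constant [#|D|]. *)
Definition cell_count e n := #|porbits n| + #|porbits e| + #|porbits (e * n)%g|.

Definition label_links e lab : {set T * T} :=
  [set (lab d, lab (e d)) | d in [set d | lab (e d) != lab d]].

(* Connectedness of the label classes: a two-colouring of the darts that is
   constant around vertices and along the edges inside the classes is constant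
   on the classes. *)
Definition connected_labels e n lab := forall g : D -> bool,
  (forall d, g (n d) = g d) ->
  (forall d, lab (e d) = lab d -> g (e d) = g d) ->
  forall d d', lab d = lab d' -> g d = g d'.

Definition del_edge e d := (tperm d (e d) * e)%g.

Lemma del_edgeE e d x : involutive e ->
  del_edge e d x = if (x == d) || (x == e d) then x else e x.
Proof.
move=> eK; rewrite permM; case: tpermP => [->|->|].
- by rewrite eK eqxx.
- by rewrite eqxx orbT.
- by move=> /eqP/negbTE-> /eqP/negbTE->.
Qed.

Lemma del_edge_inv e d : involutive e -> involutive (del_edge e d).
Proof.
move=> eK x; rewrite (del_edgeE d x) //; case: ifP => H; rewrite del_edgeE ?H //.
have -> : (e x == d) = (x == e d) by rewrite -{1}[d]eK (inj_eq perm_inj).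
by rewrite (inj_eq perm_inj) orbC H eK.
Qed.

Lemma card_moved_del e d : involutive e -> e d != d ->
  #|[set x | del_edge e d x != x]| < #|[set x | e x != x]|.
Proof.
move=> eK ed; apply: proper_card; apply/properP; split.
  apply/subsetP => x; rewrite !inE del_edgeE //.
  by case: ifP => // _; rewrite eqxx.
by exists d; rewrite !inE ?del_edgeE // eqxx //= eqxx.
Qed.

(** Deletion gains one orbit of [e] and costs at most one orbit of [e * n]. *)
Lemma cell_count_delete e n d : e d != d ->
  cell_count e n <= cell_count (del_edge e d) n.
Proof.
move=> ed; rewrite /cell_count /del_edge card_porbits_split // -mulgA.
by rewrite addnA -[_ + 1 + _]addnA leq_add2l [1 + _]addnC card_porbits_tperm_ge.
Qed.

(** Delete, one at a time, edges with equal end labels and edges with the same end labels as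
    another: no link is lost and the cell count does not drop. What remains is simple, so
    [card_faces] applies and its darts correspond to the links. *)
Lemma sparse_cell_count e n lab : involutive e -> (forall d, lab (n d) = lab d) ->
  6 * cell_count e n + #|label_links e lab| <= 6 * #|D| + 12 * #|porbits n|.
Proof.
have [N] := ubnP #|[set x | e x != x]|; elim: N e => // N IH e leN eK labn.
have step d : e d != d -> label_links e lab \subset label_links (del_edge e d) lab ->
    6 * cell_count e n + #|label_links e lab| <= 6 * #|D| + 12 * #|porbits n|.
  move=> ed /subset_leq_card sub.
  have lt := card_moved_del eK ed.
  have := IH (del_edge e d) (leq_trans lt leN) (del_edge_inv d eK) labn.
  have := cell_count_delete n ed; lia.
case: (pickP [pred d | (e d != d) && (lab (e d) == lab d)]).
  move=> d /= /andP[ed /eqP led]; apply: (step d) => //.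
  apply/subsetP => y /imsetP[x lx ->] {y}; rewrite inE in lx.
  have xE : del_edge e d x = e x.
    rewrite del_edgeE // ifF //; apply: contraNF lx => /orP[]/eqP->.
      by rewrite led.
    by rewrite eK led.
  by apply/imsetP; exists x; rewrite ?inE xE.
move=> loopless.
have lab_e d : e d != d -> lab (e d) != lab d.
  by move=> ed; have := loopless d; rewrite /= ed => /negbT.
case: (pickP [pred z : D * D | [&& e z.1 != z.1, e z.2 != z.2, z.1 != z.2,
    lab z.1 == lab z.2 & lab (e z.1) == lab (e z.2)]]).
  move=> [d d'] /= /and5P[ed ed' dd' /eqP l1 /eqP l2]; apply: (step d') => //.
  (* Together with [dd'] this puts [d] and [d'] on different edges, so [d] and [e d] still witness
     both links after the deletion. *)
  have de' : d != e d' by apply: contraTneq (lab_e _ ed') => <-; rewrite l1 eqxx.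
  have dE : del_edge e d' d = e d.
    by rewrite del_edgeE // (negbTE dd') (negbTE de').
  have edE : del_edge e d' (e d) = d by rewrite -dE del_edge_inv.
  apply/subsetP => y /imsetP[x lx ->] {y}; rewrite inE in lx.
  have [->|xd] := eqVneq x d'.
    apply/imsetP; exists d; first by rewrite inE dE lab_e.
    by rewrite dE l1 l2.
  have [->|xed] := eqVneq x (e d').
    apply/imsetP; exists (e d); first by rewrite inE edE eq_sym lab_e.
    by rewrite edE eK l1 l2.
  have xE : del_edge e d' x = e x.
    by rewrite del_edgeE // (negbTE xd) (negbTE xed).
  by apply/imsetP; exists x; rewrite ?inE xE.
move=> simple.
have lab_simple d d' : e d != d -> e d' != d' -> lab d = lab d' ->
    lab (e d) = lab (e d') -> d = d'.
  move=> ed ed' l1 l2; apply/eqP; have := simple (d, d').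
  by rewrite /= ed ed' l1 l2 !eqxx /= andbT => /negbFE.
have faces := card_faces eK labn lab_e lab_simple.
have links := card_labels lab_simple.
have EL : [set (lab d, lab (e d)) | d in [set d | e d != d]] = label_links e lab.
  rewrite /label_links; congr imset.
  suff -> : [set d | e d != d] = [set d | lab (e d) != lab d] by [].
  apply/setP => d; rewrite !inE; apply/idP/idP => [/lab_e//|].
  by apply: contraNneq => ->.
(* Here [6F <= 6P + 2M] and [6E = 6c - 3M], so the count is at most [6c + 12P - M], and [M = L]. *)
have arith F P M L E c : 3 * F <= 3 * P + M -> M = L -> 2 * E + M = 2 * c ->
  6 * (P + E + F) + L <= 6 * c + 12 * P by lia.
by rewrite EL in links; apply: arith faces links (card_porbits_involution eK).
Qed.

(** Contract edges joining two different vertices of the same label: one vertex is lost, one orbit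
    of [e] is gained and the faces are unchanged. At the end each occurring label is one vertex, and
    [sparse_cell_count] applies with at most [#|T|] vertices. *)
Lemma contracted_cell_count e n lab : involutive e ->
  (forall d, lab (n d) = lab d) -> connected_labels e n lab ->
  6 * cell_count e n + #|label_links e lab| <= 6 * #|D| + 12 * #|T|.
Proof.
have [N] := ubnP #|porbits n|; elim: N e n => // N IH e n leN eK labn con.
case: (pickP [pred d | (lab (e d) == lab d) && (d \notin porbit n (e d))]).
  move=> d /= /andP[/eqP led ndd].
  set t := tperm d (e d).
  have te : (e * t = del_edge e d)%g.
    have := tpermJ d (e d) e; rewrite eK [tperm (e d) d]tpermC => tJ.
    by rewrite /del_edge [RHS]conjgC tJ.
  have labt x : lab (t x) = lab x by rewrite /t; case: tpermP => // ->.
  have linkS : label_links e lab \subset label_links (del_edge e d) lab.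
    apply/subsetP => y /imsetP[x lx ->] {y}; rewrite inE in lx.
    have xE : del_edge e d x = e x.
      rewrite del_edgeE // ifF //; apply: contraNF lx => /orP[]/eqP->.
        by rewrite led.
      by rewrite eK led.
    by apply/imsetP; exists x; rewrite ?inE xE.
  have merge := card_porbits_merge ndd.
  have ed : e d != d by apply: contraNneq ndd => ->; rewrite porbit_id.
  have lt : #|porbits (t * n)| < N by rewrite -ltnS -[X in X < _]addn1 merge.
  have labtn x : lab ((t * n)%g x) = lab x by rewrite permM labn labt.
  have := IH (del_edge e d) (t * n)%g lt (del_edge_inv d eK) labtn.
  have -> : cell_count (del_edge e d) (t * n) = cell_count e n.
    rewrite /cell_count -{2}te -mulgA [(t * (t * n))%g]mulgA tperm2 mul1g.
    by rewrite card_porbits_split // -merge -!addnA; congr (_ + _); rewrite addnCA.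
  move=> H; apply: leq_trans (H _); first by rewrite leq_add2l subset_leq_card.
  (* A colouring admissible after the contraction is admissible before it, since it agrees on the
     two merged ends [d] and [e d]. *)
  move=> g gn ge.
  have [gd {}gn] := merge_invariant ndd gn.
  apply: con => // x.
  move=> lx; have := ge x; rewrite del_edgeE //.
  case: ifP => [/orP[]/eqP-> _|_]; [exact/esym|by rewrite eK|exact].
move=> done.
apply: leq_trans (sparse_cell_count eK labn) _.
rewrite leq_add2l leq_mul2l /=.
(* No edge inside a class joins different vertices any more, so the indicator of a vertex is an
   admissible colouring and the class is that vertex. *)
have orb d : porbit n d = [set x | lab x == lab d].
  apply/setP => x; rewrite inE; apply/idP/eqP; first exact: porbit_invariant.
  move=> lx; rewrite -(con (fun y => y \in porbit n d) _ _ d x) ?porbit_id //.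
    by move=> y; rewrite -!eq_porbit_mem; congr (_ == _); exact: (porbit_perm n 1).
  move=> y ly; have := done y; rewrite /= ly eqxx /= => /negbFE.
  by rewrite -!eq_porbit_mem => /eqP->.
apply: leq_trans (_ : #|[set [set x | lab x == a] | a : T]| <= _); last first.
  by apply: leq_trans (leq_imset_card _ _) _.
apply: subset_leq_card; apply/subsetP => _ /imsetP[d _ ->].
by rewrite orb; apply/imsetP; exists (lab d).
Qed.

End Minors.

(** * Surfaces *)

Lemma genus_embeddable (V : finType) (E : {set {set V}}) : embeddable E (genus E).
Proof. by rewrite /genus; case: ex_minnP => h /boolp.asboolP. Qed.

Lemma genus_min (V : finType) (E : {set {set V}}) h : embeddable E h -> genus E <= h.
Proof. by move=> emb; rewrite /genus; case: ex_minnP => m _; apply; apply/boolp.asboolP. Qed.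

Lemma card_sedge (S : surface) : 2 * #|porbits (sedge S)| = #|dart S|.
Proof.
have := card_porbits_involution (@sedgeK S).
have -> : [set d | sedge S d != d] = setT.
  by apply/setP => d; rewrite !inE sedge_neq.
rewrite cardsT => EE; apply: (@addIn #|dart S|); by rewrite EE addnn mul2n.
Qed.

(** With two darts to an edge, the cell count is [#|dart S| + 2 - 2h]. *)
Lemma label_links_bound (S : surface) (T : finType) (lab : dart S -> T) h :
  has_handles S h -> (forall d, lab (snode S d) = lab d) ->
  connected_labels (sedge S) (snode S) lab ->
  #|label_links (sedge S) lab| + 12 <= 12 * h + 12 * #|T|.
Proof.
rewrite /has_handles /sface => Hh labn con.
have := contracted_cell_count (@sedgeK S) labn con; rewrite /cell_count.
have := card_sedge S; move: Hh.
move: #|porbits (snode S)| #|porbits (sedge S)| #|porbits (sedge S * snode S)%g|.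
move: #|label_links _ _| => L N E F; lia.
Qed.

(* Cells of the surface that are not vertices of the drawing receive the label
   of some neighbouring cell. *)
Lemma extend_labels (S : surface) (T : finType) (L : dart S -> option T) :
  (exists d, L d != None) -> (forall d, L (snode S d) = L d) ->
  (forall g : dart S -> bool, (forall d, g (snode S d) = g d) ->
     (forall d, L d != None -> L (sedge S d) = L d -> g (sedge S d) = g d) ->
     forall d d', L d != None -> L d = L d' -> g d = g d') ->
  exists lab : dart S -> T,
    [/\ forall d a, L d = Some a -> lab d = a,
        forall d, lab (snode S d) = lab d &
        connected_labels (sedge S) (snode S) lab].
Proof.
have [N] := ubnP #|[set d | L d == None]|; elim: N L => // N IH L leN [d0 Ld0] Ln Lc.
case: (pickP [pred d | (L d != None) && (L (sedge S d) == None)]); last first.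
  move=> closed.
  (* With no unlabelled neighbour of a labelled cell left, connectedness of the surface makes every
     dart labelled. *)
  have all d : L d != None.
    have /connectP[p pp ->] := surface_connected d0 d.
    elim: p d0 Ld0 pp => //= x p IHp d0 Ld0 /andP[/orP[]/eqP xE pp]; apply: IHp pp.
      by have := closed d0; rewrite /= Ld0 xE => /negbT.
    by rewrite xE Ln.
  case a0E: (L d0) (Ld0) => [a0|//] _.
  have LE d : L d = Some (odflt a0 (L d)) by case: (L d) (all d).
  exists (fun d => odflt a0 (L d)); split.
  - by move=> d a ->.
  - by move=> d; rewrite Ln.
  move=> g gn ge d d' ldd'; apply: Lc => //; last by rewrite LE ldd' -LE.
  by move=> x _ lx; apply: ge; rewrite lx.
move=> d1 /= /andP[L1 /eqP L2].
pose L' x := if x \in porbit (snode S) (sedge S d1) then L d1 else L x.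
have L'n d : L' (snode S d) = L' d.
  by rewrite /L' Ln -!eq_porbit_mem; congr (if _ == _ then _ else _); exact: (porbit_perm (snode S) 1).
have L0 x : x \in porbit (snode S) (sedge S d1) -> L x = None.
  by move=> /(porbit_invariant Ln)->.
have LL' x : L x != None -> L' x = L x.
  by rewrite /L'; case: ifP => // /L0->.
have ltN : #|[set d | L' d == None]| < N.
  rewrite -ltnS; apply: leq_trans leN; rewrite ltnS; apply: proper_card; apply/properP; split.
    by apply/subsetP => x; rewrite !inE; apply: contraTT => Lx; rewrite LL'.
  by exists (sedge S d1); rewrite !inE ?L2 // /L' porbit_id.
have [||lab [ext labn con]] := IH L' ltN _ L'n.
- by exists d0; rewrite LL'.
- move=> g gn ge.
  have gc : forall d d', L d != None -> L d = L d' -> g d = g d'.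
    apply: Lc => // d Ld Le; apply: ge; rewrite ?LL' // Le //.
  (* A newly labelled dart has the colour of [d1], because the edge of [d1] now lies inside a
     class. *)
  have gL' d : L' d != None -> exists2 d', L d' = L' d & g d' = g d.
    rewrite /L'; case: ifP => [dO _|_ Ld]; last by exists d.
    exists d1 => //; rewrite (porbit_invariant gn dO); apply/esym/ge.
      by rewrite LL'.
    by rewrite (LL' d1) // /L' porbit_id.
  move=> d d' Ld Ldd'.
  have [x Lx <-] := gL' d Ld; rewrite Ldd' in Lx Ld.
  have [x' Lx' <-] := gL' d' Ld.
  by apply: gc; rewrite ?Lx // Lx'.
exists lab; split=> // d a Lda.
by apply: ext; rewrite LL' Lda.
Qed.

(** Each fibre of [p] induces a connected subgraph; the form by two-colourings matches
    [connected_labels]. *)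
Definition connected_parts (V T : finType) (E : {set {set V}}) (p : V -> T) :=
  forall c : V -> bool, (forall u v, adj E u v -> p u = p v -> c u = c v) ->
  forall u v, p u = p v -> c u = c v.

(** Label the cell of each vertex [v] by [p v] and extend to the whole surface; adjacent distinct
    parts then give links in [label_links_bound]. The vertex [v0] provides a first labelled cell. *)
Lemma genus_contraction (V T : finType) (E : {set {set V}}) (p : V -> T) (v0 : V) :
  connected_parts E p ->
  #|[set z : T * T | (z.1 != z.2) &&
      [exists u, exists v, [&& adj E u v, p u == z.1 & p v == z.2]]]| + 12
    <= 12 * genus E + 12 * #|T|.
Proof.
move=> con; have [S [Sh [phi [phi_inj phi_adj]]]] := genus_embeddable E.
pose L d := omap p [pick v | d \in porbit (snode S) (phi v)].
have LE d v : d \in porbit (snode S) (phi v) -> L d = Some (p v).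
  rewrite /L => dv; case: pickP => [u du|/(_ v)]; last by rewrite dv.
  congr (Some (p _)); apply: phi_inj.
  by move: du dv; rewrite -!eq_porbit_mem => /eqP<-.
have LN d : L d != None -> exists2 v, d \in porbit (snode S) (phi v) & L d = Some (p v).
  rewrite {1}/L; case: pickP => // v dv _; exists v => //; exact: LE.
have [|||lab [ext labn labc]] := @extend_labels S T L.
- by exists (phi v0); rewrite (LE _ v0) ?porbit_id.
- move=> d; rewrite /L; congr (omap p _); apply: eq_pick => v /=.
  rewrite -!eq_porbit_mem; congr (_ == _); exact: (porbit_perm (snode S) 1).
- move=> g gn ge d d' Ld Ldd'.
  have [u du Lu] := LN d Ld; have [|v dv Lv] := LN d'; first by rewrite -Ldd'.
  rewrite (porbit_invariant gn du) (porbit_invariant gn dv).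
  apply: (con (g \o phi)); last by move: Ldd'; rewrite Lu Lv => -[].
  move=> x y xy pxy; have [z [zx zy]] := phi_adj x y xy.
  rewrite /= -(porbit_invariant gn zx) -(porbit_invariant gn zy); apply/esym/ge.
    by rewrite (LE _ _ zx).
  by rewrite (LE _ _ zx) (LE _ _ zy) pxy.
apply: leq_trans (label_links_bound Sh labn labc).
rewrite leq_add2r; apply: subset_leq_card; apply/subsetP => -[a b].
rewrite inE /= => /andP[ab /existsP[u /existsP[v /and3P[uv /eqP pu /eqP pv]]]].
have [d [du dv]] := phi_adj u v uv.
have la : lab d = a by rewrite (ext _ _ (LE _ _ du)).
have lb : lab (sedge S d) = b by rewrite (ext _ _ (LE _ _ dv)).
by apply/imsetP; exists d; rewrite ?inE la lb // eq_sym.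
Qed.

Lemma genus_subset (V : finType) (E F : {set {set V}}) :
  E \subset F -> genus E <= genus F.
Proof.
move=> EF; apply: genus_min; have [S [Sh [phi [inj ad]]]] := genus_embeddable F.
exists S; split=> //; exists phi; split=> // u v /andP[uv uvE].
by apply: ad; rewrite /adj /= uv (subsetP EF).
Qed.

(** * Adding an edge *)

Section SumPerm.
Variables (D1 D2 : finType) (s : {perm D1}) (r : {perm D2}).

Definition sum_fun (x : D1 + D2) : D1 + D2 :=
  match x with inl d => inl (s d) | inr c => inr (r c) end.

Fact sum_fun_inj : injective sum_fun.
Proof. by move=> [x|x] [y|y] //= [] /perm_inj->. Qed.

Definition sum_perm : {perm D1 + D2} := perm sum_fun_inj.

Lemma sum_permE x : sum_perm x = sum_fun x.
Proof. exact: permE. Qed.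

Lemma porbit_suml d : porbit sum_perm (inl d) = inl @: porbit s d.
Proof.
apply/setP => y; apply/idP/idP => [|/imsetP[x dx ->]].
  apply: (porbit_closed (P := fun y => y \in inl @: porbit s d)) => //.
    by rewrite imset_f ?porbit_id.
  by move=> z /imsetP[x dx ->]; rewrite sum_permE /= imset_f ?porbit_step.
move: x dx; apply: porbit_closed; first exact: porbit_id.
by move=> x /porbit_step; rewrite sum_permE.
Qed.

Lemma porbit_sumr d : porbit sum_perm (inr d) = inr @: porbit r d.
Proof.
apply/setP => y; apply/idP/idP => [|/imsetP[x dx ->]].
  apply: (porbit_closed (P := fun y => y \in inr @: porbit r d)) => //.
    by rewrite imset_f ?porbit_id.
  by move=> z /imsetP[x dx ->]; rewrite sum_permE /= imset_f ?porbit_step.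
move: x dx; apply: porbit_closed; first exact: porbit_id.
by move=> x /porbit_step; rewrite sum_permE.
Qed.

Lemma card_porbits_sum : #|porbits sum_perm| = #|porbits s| + #|porbits r|.
Proof.
have imset_inj (A B : finType) (f : A -> B) : injective f ->
    injective (fun X : {set A} => f @: X).
  by move=> fi X Y /setP XY; apply/setP => x; have := XY (f x); rewrite !mem_imset.
have -> : porbits sum_perm = [set inl @: (A : {set D1}) | A in porbits s]
    :|: [set inr @: (B : {set D2}) | B in porbits r].
  apply/setP => X; rewrite inE; apply/imsetP/orP.
    case=> [[d|d] _ ->]; [left|right]; rewrite ?porbit_suml ?porbit_sumr.
      by apply: imset_f; apply: imset_f.
    by apply: imset_f; apply: imset_f.
  case=> /imsetP[_ /imsetP[d _ ->] ->]; [exists (inl d)|exists (inr d)] => //.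
    by rewrite porbit_suml.
  by rewrite porbit_sumr.
rewrite cardsU (card_imset _ (imset_inj _ _ _ (@inl_inj D1 D2))).
rewrite (card_imset _ (imset_inj _ _ _ (@inr_inj D1 D2))).
rewrite -[RHS]subn0; congr (_ - _); apply/eqP; rewrite cards_eq0; apply/eqP/setP => X.
rewrite !inE; apply/negP => /andP[/imsetP[_ /imsetP[d _ ->] ->]].
case/imsetP=> B _ /setP/(_ (inl d)); rewrite imset_f ?porbit_id //.
by move/esym/imsetP => [].
Qed.

End SumPerm.

Lemma sum_permM (D1 D2 : finType) (s s' : {perm D1}) (r r' : {perm D2}) :
  (sum_perm s r * sum_perm s' r' = sum_perm (s * s') (r * r'))%g.
Proof. by apply/permP => -[d|d]; rewrite permM !sum_permE /= permM. Qed.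

Lemma closed_invariant (D : finType) (s : {perm D}) (g : D -> bool) :
  (forall d, g d -> g (s d)) -> forall d, g (s d) = g d.
Proof.
move=> gs d; apply/idP/idP => [gsd|/gs//].
by apply: (@porbit_closed _ s g (s d)) => //; rewrite porbit_sym porbit_step ?porbit_id.
Qed.

Section AddEdge.
Variables (S : surface) (a b : dart S).

(** The new edge starts on a separate sphere: [e0] swaps its darts [true] and [false], each alone at
    its vertex in [n0]. Then [n1] and [n2] merge its ends into the 0-cells of [b] and [a]. *)
Let e0 : {perm dart S + bool} := sum_perm (sedge S) (tperm true false).
Let n0 : {perm dart S + bool} := sum_perm (snode S) 1.
Let n1 : {perm dart S + bool} := (tperm (inl b) (inr false) * n0)%g.
Let n2 : {perm dart S + bool} := (tperm (inl a) (inr true) * n1)%g.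

Fact e0K : involutive e0.
Proof. by move=> [d|c]; rewrite !sum_permE /= ?sedgeK ?tpermK. Qed.

Fact e0_neq d : e0 d != d.
Proof.
case: d => [d|c]; rewrite sum_permE /=; last by case: c; rewrite ?tpermL ?tpermR.
by rewrite (inj_eq (@inl_inj _ _)) sedge_neq.
Qed.

Fact n0_sep : inl b \notin porbit n0 (inr false).
Proof. by rewrite porbit_sumr; apply/imsetP => -[]. Qed.

Fact n1_sep : inl a \notin porbit n1 (inr true).
Proof.
apply/negP => /(porbit_closed (P := fun x => x == inr true)) /= H.
suff : inl a == inr true :> dart S + bool by [].
apply: H => // _ /eqP->; rewrite permM tpermD //.
by rewrite sum_permE /= perm1.
Qed.

Lemma add_edge_invariant (T : Type) (g : dart S + bool -> T) :
  (forall d, g (n2 d) = g d) ->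
  [/\ g (inl a) = g (inr true), g (inl b) = g (inr false) &
      forall d, g (inl (snode S d)) = g (inl d)].
Proof.
move=> /(merge_invariant n1_sep)[ga] /(merge_invariant n0_sep)[gb gn].
by split=> // d; have := gn (inl d); rewrite sum_permE.
Qed.

Fact add_edge_gt0 : 0 < #|{: dart S + bool}|.
Proof. by apply/card_gt0P; exists (inr true). Qed.

Fact add_edge_connected x y :
  connect [rel d d' | (d' == e0 d) || (d' == n2 d)] x y.
Proof.
set r := [rel d d' | _]; pose g y := connect r x y.
have gS d d' : r d d' -> g d -> g d'.
  move=> rdd'; rewrite /g => gd; apply: connect_trans gd _; exact: connect1.
have ge : forall d, g (e0 d) = g d.
  by apply: closed_invariant => d; apply: gS; rewrite /= eqxx.
have [ga gb gn] := add_edge_invariant (closed_invariant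
  (fun d => @gS d (n2 d) ltac:(by rewrite /= eqxx orbT))).
have gl d : g (inl d) = g (inl a).
  have /connectP[p pp ->] := surface_connected a d.
  elim: p a pp => //= z p IHp a' /andP[/orP[]/eqP-> pp]; rewrite IHp //.
  by have := ge (inl a'); rewrite sum_permE.
have gA z : g z = g (inl a).
  by case: z => [d|[]]; rewrite ?gl // -gb gl.
by rewrite -/(g y) gA -(gA x); apply: connect0.
Qed.

Definition add_edge : surface :=
  Surface e0K e0_neq add_edge_gt0 add_edge_connected.

Lemma add_edge_handles h : has_handles S h ->
  exists2 h', has_handles add_edge h' & h' <= h + 1.
Proof.
have c1 : #|porbits (1 : {perm bool})| = 2.
  have := @card_porbits_involution bool 1 _; rewrite card_bool.
  have -> : [set d : bool | (1 : {perm bool})%g d != d] = set0.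
    by apply/setP => d; rewrite !inE perm1 eqxx.
  rewrite cards0 => H; suff : 2 * #|porbits (1 : {perm bool})| + 0 = 2 * 2 by lia.
  by apply: H => d; rewrite !perm1.
have ct : #|porbits (tperm true false)| = 1.
  have := card_porbits_merge (s := (1 : {perm bool})) (x := true) (y := false).
  rewrite mulg1 c1 => H; suff : #|porbits (tperm true false)| + 1 = 2 by lia.
  apply: H; apply/negP => /(porbit_closed (P := fun x => x == false)) H.
  by suff : true == false by []; apply: H => // d; rewrite perm1.
have cn : #|porbits n2| + 2 = #|porbits (snode S)| + 2.
  rewrite -{2}c1 -card_porbits_sum -(card_porbits_merge n0_sep).
  by rewrite -(card_porbits_merge n1_sep) -addnA.
have ce : #|porbits e0| = #|porbits (sedge S)| + 1 by rewrite card_porbits_sum ct.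
(* A transposition moves across [e0] by conjugation, so both merges act directly on the faces of
   [e0 * n0]. *)
have mv x y s : (e0 * (tperm x y * s) = tperm (e0 x) (e0 y) * (e0 * s))%g.
  rewrite !mulgA; congr (_ * s)%g.
  by have := tpermJ (e0 x) (e0 y) e0; rewrite !e0K => <-; rewrite -conjgC.
have fE : (e0 * n2 = tperm (e0 (inl a)) (e0 (inr true)) *
   (tperm (e0 (inl b)) (e0 (inr false)) * (e0 * n0)))%g.
  by rewrite !mv.
(* The first one joins the only face of the separate edge to a face of [S]. *)
have cf : #|porbits (tperm (e0 (inl b)) (e0 (inr false)) * (e0 * n0))%g|
    = #|porbits (sface S)|.
  apply: (@addIn 1); rewrite card_porbits_merge.
    by rewrite sum_permM card_porbits_sum mulg1 ct.
  by rewrite sum_permM !sum_permE porbit_sumr; apply/imsetP => -[].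
have := porbits_mul_tperm (tperm (e0 (inl b)) (e0 (inr false)) * (e0 * n0))%g
   (e0 (inl a)) (e0 (inr true)).
rewrite /= -fE cf (inj_eq perm_inj) /= /has_handles /sface /= -/e0 -/n2 ce.
move/addIn: cn => ->.
(* The second joins two faces, which costs a handle, or cuts one face in two, which costs none. *)
case: (_ \notin _) => /=.
  move: #|porbits (snode S)| #|porbits (sedge S)| #|porbits (sedge S * snode S)%g|.
  move: #|porbits (e0 * n2)%g| => F' N E F cF hh.
  exists (h + 1) => //; lia.
move: #|porbits (snode S)| #|porbits (sedge S)| #|porbits (sedge S * snode S)%g|.
move: #|porbits (e0 * n2)%g| => F' N E F cF hh.
exists h; lia.
Qed.

Lemma porbit_add_edge x y :
  (inl x \in porbit n2 (inl y)) = (x \in porbit (snode S) y).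
Proof.
apply/idP/idP; last first.
  have [_ _] := add_edge_invariant (g := fun z => z \in porbit n2 (inl y))
    (closed_invariant (fun d => @porbit_step _ n2 _ d)).
  move=> gn xy; rewrite (porbit_invariant (g := fun d => inl d \in _) gn xy).
  exact: porbit_id.
(* Invariant for the other direction: each new dart is sent to the old cell it was attached to. *)
pose q z := match z with inl d => porbit (snode S) d
  | inr true => porbit (snode S) a | inr false => porbit (snode S) b end.
have qn d : q (n2 d) = q d.
  have q0 z : q (n0 z) = q z.
    rewrite sum_permE; case: z => [d'|[]] /=; rewrite ?perm1 //.
    exact: (porbit_perm (snode S) 1).
  rewrite /n2 /n1 !permM q0.
  have qt1 z : q (tperm (inl b) (inr false) z) = q z by case: tpermP => // ->.
  by rewrite qt1; case: tpermP => // ->.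
by move=> /(porbit_invariant qn) /= xy; rewrite -eq_porbit_mem xy.
Qed.

Lemma porbit_add_edgel : inr true \in porbit n2 (inl a).
Proof.
have [<- _ _] := add_edge_invariant (g := fun z => z \in porbit n2 (inl a))
    (closed_invariant (fun d => @porbit_step _ n2 _ d)).
exact: porbit_id.
Qed.

Lemma porbit_add_edger : inr false \in porbit n2 (inl b).
Proof.
have [_ <- _] := add_edge_invariant (g := fun z => z \in porbit n2 (inl b))
    (closed_invariant (fun d => @porbit_step _ n2 _ d)).
exact: porbit_id.
Qed.

End AddEdge.

Lemma genus_add_edge (V : finType) (E : {set {set V}}) (f : {set V}) :
  #|f| = 2 -> genus (f |: E) <= genus E + 1.
Proof.
move=> /eqP/cards2P[u [v [uv ->]]].
have [S [Sh [phi [phi_inj phi_adj]]]] := genus_embeddable E.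
have [h' Sh' le_h'] := add_edge_handles (phi u) (phi v) Sh.
apply: leq_trans le_h'; apply: genus_min.
exists (add_edge (phi u) (phi v)); split=> //; exists (fun x => inl (phi x)).
split=> [x y|x y]; rewrite /=; first by rewrite porbit_add_edge; apply: phi_inj.
rewrite /adj /= !inE => /andP[xy /orP[/eqP /setP xyuv|xyE]]; last first.
  have [|d [dx dy]] := phi_adj x y; first by rewrite /adj /= xy.
  by exists (inl d); rewrite sum_permE /= !porbit_add_edge.
have xu := xyuv x; have yu := xyuv y; move: xu yu.
rewrite !inE !eqxx orbT /=; move: xy.
case: (eqVneq x u) => [->|xu].
  rewrite eq_sym => /negbTE-> /= _ /esym/eqP->; exists (inr true).
  rewrite sum_permE /= tpermL; split; [exact: porbit_add_edgel|exact: porbit_add_edger].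
case: (eqVneq x v) => // -> vy _; rewrite [y == v]eq_sym (negbTE vy) orbF => /esym/eqP->.
exists (inr false); rewrite sum_permE /= tpermR.
split; [exact: porbit_add_edger|exact: porbit_add_edgel].
Qed.

Lemma genus_add_edges (V : finType) (E F : {set {set V}}) :
  F \subset vpairs V -> genus (E :|: F) <= genus E + #|F|.
Proof.
have [N] := ubnP #|F|; elim: N F => // N IH F leN FV.
have [->|[f fF]] := set_0Vmem F; first by rewrite setU0 leq_addr.
have FE : F = f |: F :\ f by rewrite setD1K.
have cF : #|F| = (#|F :\ f|).+1 by rewrite (cardsD1 f F) fF.
rewrite {1}FE setUCA cF addnS -addn1; apply: leq_trans (genus_add_edge _ _) _.
  by move: (subsetP FV f fF); rewrite inE => /eqP.
rewrite leq_add2r IH //; first by rewrite -ltnS -cF.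
by apply: subset_trans FV; apply: subsetDl.
Qed.

(** * Partitions into connected parts of bounded size *)

Section Split.
Variables (V : finType) (r : rel V) (Delta : nat).
Hypothesis r_sym : symmetric r.
Hypothesis r_deg : forall v, #|r v| <= Delta.
Implicit Types A C W : {set V}.

Definition connected_in W := forall c : V -> bool,
  (forall u v, u \in W -> v \in W -> r u v -> c u = c v) ->
  forall u v, u \in W -> v \in W -> c u = c v.

Definition component A x :=
  [set y | connect [rel u v | [&& u \in A, v \in A & r u v]] x y].

Fact component_sym A x y : (y \in component A x) = (x \in component A y).
Proof.
rewrite !inE; apply: sym_connect_sym => u v /=.
by rewrite andbCA r_sym.
Qed.

Fact component_trans A x y z :
  y \in component A x -> z \in component A y -> z \in component A x.
Proof. by rewrite !inE; apply: connect_trans. Qed.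

Fact component_sub A x : x \in A -> component A x \subset A.
Proof.
move=> xA; apply/subsetP => y; rewrite inE => /connectP[p pp ->].
by elim: p x xA pp => //= z p IH x xA /andP[/and3P[_ zA _]]; apply: IH.
Qed.

Fact component_connected A x : connected_in (component A x).
Proof.
move=> c cC; suff H y : y \in component A x -> c y = c x.
  by move=> u v /H-> /H->.
rewrite inE => /connectP[p pp ->].
have xx : x \in component A x by rewrite inE connect0.
move: xx pp; move: {1 3 4 5}x => u; elim: p u => //= z p IH u uC /andP[uz pp].
have zC : z \in component A x.
  by apply: component_trans uC _; rewrite inE connect1.
rewrite (IH z) //; apply/esym/cC => //.
by case/and3P: uz.
Qed.

(** A component without a neighbour of [a] would have an indicator constant on [A], though it
    contains [x] and not [a]. *)
Fact component_attached A a x : connected_in A -> a \in A -> x \in A :\ a ->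
  exists2 y, y \in component (A :\ a) x & r a y.
Proof.
move=> conA aA xA; set C := component _ _.
case: (pickP [pred y in C | r a y]) => [y /andP[yC ay]|none]; first by exists y.
have /(_ x a) : forall u v, u \in A -> v \in A -> (u \in C) = (v \in C).
  apply: conA; suff H u v : u \in A -> v \in A -> r u v -> u \in C -> v \in C.
    by move=> u v uA vA uv; apply/idP/idP; apply: H; rewrite // r_sym.
  move=> uA vA uv uC.
  have uA' : u \in A :\ a by apply: (subsetP (component_sub xA)).
  have [va|va] := eqVneq v a.
    by have := none u; rewrite /= uC r_sym -va uv.
  by apply: component_trans uC _; rewrite inE connect1 //= uA' uv !inE va vA.
have -> : x \in C by rewrite inE connect0.
have -> : (a \in C) = false.
  by apply/negP => /(subsetP (component_sub xA)); rewrite !inE eqxx.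
by move: xA; rewrite inE => /andP[_ xA] /(_ xA aA).
Qed.

(** Shrink a connected [A] with connected complement, starting from [W]. Remove a vertex [a]
    adjacent to the complement: at most [Delta] components remain, each attached to [a], so if [A]
    is too large one of them has at least [s] vertices and becomes the new [A]. *)
Lemma split_off s W : 0 < s -> s <= #|W| -> connected_in W ->
  exists A, [/\ A \subset W, s <= #|A| <= Delta * s + 1,
    connected_in A & connected_in (W :\: A)].
Proof.
move=> s0 sW conW.
suff H A : A \subset W -> s <= #|A| -> connected_in A -> connected_in (W :\: A) ->
    exists A', [/\ A' \subset W, s <= #|A'| <= Delta * s + 1,
      connected_in A' & connected_in (W :\: A')].
  by apply: (H W) => //; rewrite setDv => c _ u v; rewrite inE.
have [N] := ubnP #|A|; elim: N A => // N IH A leN AW sA conA conWA.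
case: (leqP #|A| (Delta * s + 1)) => [leA|gtA]; first by exists A; rewrite sA.
have [a aA aout] : exists2 a, a \in A &
    forall v, v \in W :\: A -> exists2 b, b \in W :\: A & r a b.
  have /card_gt0P[a0 a0A] : 0 < #|A| by lia.
  (* With an empty complement any vertex of [A] serves as [a]. *)
  have [WA0|[w wWA]] := set_0Vmem (W :\: A).
    by exists a0 => // v; rewrite WA0 inE.
  case: (pickP [pred z : V * V | [&& z.1 \in A, z.2 \in W :\: A & r z.1 z.2]]).
    by move=> [a b] /= /and3P[aA bA ab]; exists a => // _ _; exists b.
  move=> none; move: (wWA); rewrite inE => /andP[wA wW].
  suff : (a0 \in A) = (w \in A) by rewrite a0A (negbTE wA).
  apply: conW wW; last by apply: (subsetP AW).
  suff H u v : u \in W -> v \in W -> r u v -> u \in A -> v \in A.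
    by move=> u v uW vW uv; apply/idP/idP; apply: H; rewrite // r_sym.
  move=> uW vW uv uA; apply/negPn/negP => vA.
  by have := none (u, v); rewrite /= uA !inE vA vW uv.
pose B := A :\ a.
have [x xB sx] : exists2 x, x \in B & s <= #|component B x|.
  case: (pickP [pred x in B | s <= #|component B x|]) => [x /andP[xB ?]|none].
    by exists x.
  suff : #|B| <= Delta * s by have := cardsD1 a A; rewrite aA -/B; lia.
  apply: (@leq_trans #|\bigcup_(y in B | r a y) component B y|).
    apply/subset_leq_card/subsetP => x xB; apply/bigcupP.
    have [y yC ay] := component_attached conA aA xB.
    exists y; last by rewrite component_sym.
    by rewrite ay andbT (subsetP (component_sub xB)).
  apply: (@leq_trans (\sum_(y in B | r a y) s)).
    elim/big_rec2: _ => [|y m X /andP[yB _] le]; first by rewrite cards0.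
    apply: leq_trans (leq_card_setU _ _) _; apply: leq_add => //.
    by have := none y; rewrite /= yB /= => /negbT; rewrite -ltnNge => /ltnW.
  rewrite sum_nat_const leq_mul2r; apply/orP; right.
  apply: leq_trans (r_deg a); apply: subset_leq_card; apply/subsetP => y.
  by rewrite !unfold_in => /andP[].
set C := component B x in sx.
have CB : C \subset B by apply: component_sub.
have CA : C \subset A by apply: subset_trans CB (subsetDl _ _).
have aC : a \notin C by apply/negP => /(subsetP CB); rewrite !inE eqxx.
apply: (IH C) => //.
- rewrite -ltnS; apply: leq_trans leN; rewrite ltnS; apply: proper_card.
  by apply/properP; split=> //; exists a.
- exact: subset_trans CA AW.
- exact: component_connected.
move=> c cW; have aWC : a \in W :\: C by rewrite inE aC (subsetP AW).
(* Everything outside [C] is tied to [a]: the old complement through [b], the other components of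
   [B] through their own neighbours of [a]. *)
suff H v : v \in W :\: C -> c v = c a by move=> u v /H-> /H->.
move=> vWC; have [vA|vA] := boolP (v \in A); last first.
  have vWA : v \in W :\: A by move: vWC; rewrite !inE vA => /andP[].
  have sub : {subset W :\: A <= W :\: C}.
    by apply/subsetP; apply: setDS.
  have [b bWA ab] := aout v vWA.
  transitivity (c b); last by apply/esym/cW => //; apply: sub.
  by apply: conWA => // u1 u2 /sub u1W /sub u2W; apply: cW.
have [->//|va] := eqVneq v a.
have vB : v \in B by rewrite !inE va.
have [y yC ay] := component_attached conA aA vB.
have sub : {subset component B v <= W :\: C}.
  move=> z zC; rewrite inE; apply/andP; split; last first.
    by apply: (subsetP AW); have := subsetP (component_sub vB) z zC; rewrite inE => /andP[].
  apply/negP => zx; move: vWC; rewrite inE => /andP[/negP[]].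
  by apply: component_trans zx _; rewrite component_sym.
transitivity (c y); last by apply/esym/cW => //; apply: sub.
have vv : v \in component B v by rewrite inE connect0.
by apply: (component_connected _ vv yC) => u1 u2 /sub ? /sub ?; apply: cW.
Qed.

(** Split off parts repeatedly; once fewer than [s] vertices would be left, they stay with the last
    part, which then has at most [Delta * s + 1 + (s - 1)] vertices. *)
Lemma connected_partition s W : 0 < s -> s <= #|W| -> connected_in W ->
  exists t (p : V -> nat), [/\ forall v, v \in W -> p v < t, t * s <= #|W| &
    forall i, #|[set v in W | p v == i]| <= (Delta + 2) * s /\
      connected_in [set v in W | p v == i]].
Proof.
move=> s0; have [N] := ubnP #|W|; elim: N W => // N IH W leN sW conW.
have [A [AW /andP[sA Al] conA conWA]] := split_off s0 sW conW.
have cWA := cardsID A W; rewrite (setIidPr AW) in cWA.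
have [small|big] := ltnP #|W :\: A| s.
  exists 1, (fun=> 0); split=> // [|i]; first by rewrite mul1n.
  case: i => [|i].
    have -> : [set v in W | 0 == 0] = W by apply/setP => v; rewrite inE andbT.
    by split=> //; lia.
  have -> : [set v in W | 0 == i.+1] = set0 by apply/setP => v; rewrite !inE andbF.
  by split=> [|c _ u v]; rewrite ?cards0 // inE.
have [|t [p [pt ts pf]]] := IH (W :\: A) _ big conWA; first by lia.
exists t.+1, (fun v => if v \in A then t else p v); split.
- move=> v vW; case: ifP => // vA; apply: ltnW; rewrite ltnS pt //.
  by rewrite inE vA.
- by rewrite mulSn; lia.
move=> i; have [->|it] := eqVneq i t.
  have -> : [set v in W | (if v \in A then t else p v) == t] = A.
    apply/setP => v; rewrite inE; case: ifP => vA; first by rewrite eqxx (subsetP AW).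
    apply/negP => /andP[vW /eqP pv]; have := pt v; rewrite pv ltnn inE vA vW.
    by move=> /(_ isT).
  by split=> //; lia.
have -> : [set v in W | (if v \in A then t else p v) == i] = [set v in W :\: A | p v == i].
  apply/setP => v; rewrite !inE; case: ifP => vA //=.
  by rewrite [t == _]eq_sym (negbTE it) andbF.
exact: pf.
Qed.

End Split.

(** * Loops and parallel edges in a random quotient *)

Lemma double_count (A B : finType) (X : {set A}) (Y : {set B}) (Q : A -> B -> bool) :
  \sum_(y in Y) #|[set x in X | Q x y]| = \sum_(x in X) #|[set y in Y | Q x y]|.
Proof.
rewrite (eq_bigr (fun y => \sum_(x in X) (Q x y : nat))); last first.
  by move=> y _; rewrite -sum1dep_card big_mkcondr.
rewrite exchange_big /=; apply: eq_bigr => x _.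
by rewrite -sum1dep_card big_mkcondr.
Qed.

Lemma card_supersets (U : finType) (P S : {set U}) k :
  S \subset P ->
  #|[set E : {set U} in [set E : {set U} | (E \subset P) && (#|E| == k)] | S \subset E]|
    <= 'C(#|P| - #|S|, k - #|S|).
Proof.
move=> SP; have -> : #|P| - #|S| = #|P :\: S|.
  by rewrite -(cardsID S P) (setIidPr SP) addKn.
rewrite -cards_draws -(card_in_imset (f := fun E : {set U} => E :\: S)).
  apply/subset_leq_card/subsetP => X /imsetP[E]; rewrite !inE.
  move=> /andP[/andP[EP /eqP <-] SE] ->; rewrite setSD //=.
  by rewrite cardsD (setIidPr SE).
move=> E E'; rewrite !inE => /andP[_ SE] /andP[_ SE'] /setP EE'.
apply/setP => x; have := EE' x; rewrite !inE; case: (boolP (x \in S)) => //= xS _.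
by rewrite (subsetP SE) ?(subsetP SE').
Qed.

Lemma card_vpairs (V : finType) : #|vpairs V| = 'C(#|V|, 2).
Proof. exact: card_draws. Qed.

Lemma card_k_edge_sets (V : finType) k : #|k_edge_sets V k| = 'C('C(#|V|, 2), k).
Proof. by rewrite -card_vpairs -cards_draws. Qed.

(** Remove [x] from [X]: either [f x] is still attained at some [y] and the pair [(x, y)] is gone,
    or the image loses a point. *)
Lemma card_collisions (A B : finType) (f : A -> B) (X : {set A}) :
  #|X| <= #|f @: X| +
    #|[set z : A * A | [&& z.1 \in X, z.2 \in X, z.1 != z.2 & f z.1 == f z.2]]|.
Proof.
have [N] := ubnP #|X|; elim: N X => // N IH X leN.
have [->|[x xX]] := set_0Vmem X; first by rewrite cards0.
have cX := cardsD1 x X; rewrite xX add1n in cX.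
have lt : #|X :\ x| < N by move: leN; rewrite cX ltnS.
have {}IH := IH _ lt.
set Z := [set z | _]; set Z' := [set z | _] in IH.
have Z'Z : Z' \subset Z.
  by apply/subsetP => z; rewrite !inE => /and4P[/andP[_ ->] /andP[_ ->] -> ->].
have fX : f @: (X :\ x) \subset f @: X by apply/imsetS/subsetDl.
have [fx|fx] := boolP (f x \in f @: (X :\ x)).
  case/imsetP: fx => y yX fxy; move: (yX); rewrite !inE => /andP[yx yX'].
  suff : #|Z'| < #|Z| by have := subset_leq_card fX; lia.
  apply: proper_card; apply/properP; split=> //; exists (x, y); rewrite !inE /=.
    by rewrite xX yX' eq_sym yx fxy eqxx.
  by rewrite eqxx.
suff : #|f @: (X :\ x)| < #|f @: X| by have := subset_leq_card Z'Z; lia.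
by apply: proper_card; apply/properP; split=> //; exists (f x) => //; apply: imset_f.
Qed.

Section RandomQuotient.
Variables (V T : finType) (p : V -> T) (M : nat).
Hypothesis fibre : forall i, #|[set v | p v == i]| <= M.

Definition inner_pairs : {set {set V}} := [set f in vpairs V | #|p @: f| != 2].

(** Ordered pairs of edges that become parallel under [p], as [inner_pairs] are those that become
    loops. *)
Definition colliding_pairs : {set {set V} * {set V}} :=
  [set z in [set z : {set V} * {set V} | (z.1 \in vpairs V) && (z.1 != z.2)] |
    [&& z.2 \in vpairs V, z.1 \notin inner_pairs & p @: z.1 == p @: z.2]].

Definition defects (E : {set {set V}}) :=
  #|[set f in inner_pairs | f \in E]| +
  #|[set z in colliding_pairs | (z.1 \in E) && (z.2 \in E)]|.

Lemma card_quotient_edges (E : {set {set V}}) : E \subset vpairs V ->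
  #|E| <= #|[set p @: (f : {set V}) | f in E :\: inner_pairs]| + defects E.
Proof.
move=> EV; have := card_collisions (fun f : {set V} => p @: f) (E :\: inner_pairs).
have -> : #|E| = #|[set f in inner_pairs | f \in E]| + #|E :\: inner_pairs|.
  by rewrite -(cardsID inner_pairs E); congr (_ + _); apply: eq_card => f; rewrite !inE andbC.
rewrite /defects; set Z := [set z : _ * _ | _].
set Z' := [set z in colliding_pairs | _].
suff ZZ' : Z \subset Z'.
  move=> le; rewrite addnCA leq_add2l; apply: leq_trans le _.
  by rewrite leq_add2l subset_leq_card.
apply/subsetP => -[f f']; rewrite in_set /= !in_setD.
move=> /and4P[/andP[f1 f2] /andP[f1' f2'] ff' pff'].
rewrite in_set /= f2 f2' in_set /= in_set /= ff' pff' f1.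
by rewrite (subsetP EV f f2) (subsetP EV f' f2').
Qed.

(** A vertex shares its fibre with at most [M.-1] others; the predecessor makes the bound vanish for
    singleton parts. *)
Lemma card_inner_pairs : #|inner_pairs| <= #|V| * M.-1.
Proof.
pose P := [set z : V * V in [set: V * V] | (p z.2 == p z.1) && (z.2 != z.1)].
have sub : inner_pairs \subset [set [set z.1; z.2] | z in P].
  apply/subsetP => f; rewrite inE => /andP[]; rewrite inE => /cards2P[u [v [uv ->]]].
  rewrite imsetU1 imset_set1 cards2 => puv; apply/imsetP; exists (u, v) => //.
  by rewrite !inE /= [v == u]eq_sym uv andbT [p v == _]eq_sym; move: puv; case: (p u == p v).
apply: leq_trans (subset_leq_card sub) _; apply: leq_trans (leq_imset_card _ _) _.
have -> : #|P| = \sum_(u : V) #|[set v | (p v == p u) && (v != u)]|.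
  rewrite -sum1dep_card (eq_bigr (fun u => \sum_(v | (p v == p u) && (v != u)) 1)).
    by rewrite pair_big_dep /=; apply: eq_bigl => z; rewrite !inE.
  by move=> u _; rewrite sum1dep_card.
rewrite -sum_nat_const; apply: leq_sum => u _.
have := fibre (p u); rewrite (cardsD1 u) inE eqxx add1n => le.
rewrite -ltnS; apply: leq_trans (leq_trans le (leqSpred M)); rewrite ltnS.
by apply: subset_leq_card; apply/subsetP => v; rewrite !inE andbC.
Qed.

(** An edge with the same image as [uv] has its ends in the fibres of [p u] and [p v]; the
    predecessor excludes [uv] itself and again gives 0 for singleton parts. *)
Lemma card_colliding_pairs : #|colliding_pairs| <= #|vpairs V| * (M * M).-1.
Proof.
have -> : #|colliding_pairs| = \sum_(f in vpairs V)
    #|[set f' in vpairs V | [&& f != f', f \notin inner_pairs & p @: f == p @: f']]|.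
  rewrite -sum1dep_card.
  rewrite (eq_bigr (fun f => \sum_(f' in vpairs V | [&& f != f', f \notin inner_pairs
     & p @: f == p @: f']) 1)); last by move=> f _; rewrite sum1dep_card.
  rewrite pair_big_dep /=; apply: eq_bigl => z; rewrite !inE /=.
  by case: (z.1 != z.2) => //=; rewrite ?andbF ?andbT.
rewrite -sum_nat_const; apply: leq_sum => f fV; set X := [set f' in _ | _].
have [fi|fi] := boolP (f \in inner_pairs).
  suff -> : X = set0 by rewrite cards0.
  by apply/setP => f'; rewrite in_set0 in_set fi /= !andbF.
move: (fV); rewrite inE => /cards2P[u [v [uv fE]]].
pose Y := setX [set x | p x == p u] [set y | p y == p v].
have puv : p u != p v.
  move: fi; rewrite in_set fV /= negbK fE imsetU1 imset_set1 cards2.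
  by case: (p u == p v).
have sub : f |: X \subset [set [set z.1; z.2] | z in Y].
  apply/subsetP => f'; rewrite in_setU1 => /orP[/eqP->|].
    by apply/imsetP; exists (u, v); rewrite ?fE // !inE !eqxx.
  rewrite in_set => /andP[]; rewrite inE => /cards2P[x [y [xy ->]]] /and3P[_ _].
  rewrite fE !imsetU1 !imset_set1 => /eqP/setP pe.
  have := pe (p x); have := pe (p y); have := pe (p u); have := pe (p v).
  rewrite !inE !eqxx !orbT /= => pv pu py px.
  have [xu|xu] := eqVneq (p x) (p u).
    apply/imsetP; exists (x, y) => //; rewrite !inE /= xu eqxx /=.
    move: pv; rewrite xu [p v == p u]eq_sym (negbTE puv) /= => /esym/eqP->.
    exact: eqxx.
  move: px; rewrite (negbTE xu) /= => xv; apply/imsetP; exists (y, x) => /=.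
    rewrite !inE /= xv andbT.
    move: pu; rewrite [p u == p x]eq_sym (negbTE xu) /= => /esym; by rewrite eq_sym.
  by rewrite setUC.
have cX : #|f |: X| = #|X|.+1.
  by rewrite cardsU1 in_set eqxx /= andbF.
have : #|X|.+1 <= M * M.
  rewrite -cX; apply: leq_trans (subset_leq_card sub) _.
  apply: leq_trans (leq_imset_card _ _) _; rewrite cardsX.
  by apply: leq_mul; apply: fibre.
by case: (M * M).
Qed.

(** An expectation with denominators cleared: a fixed pair is chosen with probability [k / N], where
    [N] is the number of pairs. For two distinct pairs it is [k (k - 1) / (N (N - 1))], used in the
    next lemma. *)
Lemma sum_inner_pairs k :
  0 < k -> \sum_(E in k_edge_sets V k) #|[set f in inner_pairs | f \in E]| * #|vpairs V|
    <= #|V| * M.-1 * k * #|k_edge_sets V k|.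
Proof.
move=> k0; rewrite card_k_edge_sets -card_vpairs; set N := #|vpairs V|.
rewrite -big_distrl /= (double_count inner_pairs _ (fun f (E : {set {set V}}) => f \in E)).
have le f : f \in inner_pairs ->
    #|[set E in k_edge_sets V k | f \in E]| <= 'C(N.-1, k.-1).
  rewrite inE => /andP[fV _]; rewrite -!subn1 -(cards1 f).
  apply: leq_trans (card_supersets _ _); last by rewrite sub1set.
  by apply: subset_leq_card; apply/subsetP => E; rewrite !inE sub1set.
apply: (@leq_trans (#|inner_pairs| * 'C(N.-1, k.-1) * N)).
  by rewrite leq_mul2r -sum_nat_const leq_sum ?orbT.
rewrite -mulnA ['C(_, _) * N]mulnC mul_bin_diag prednK // -mulnA.
by rewrite leq_mul2r card_inner_pairs orbT.
Qed.

Lemma sum_colliding_pairs k : 1 < k ->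
  \sum_(E in k_edge_sets V k)
     #|[set z in colliding_pairs | (z.1 \in E) && (z.2 \in E)]| *
     (#|vpairs V| * #|vpairs V|.-1)
    <= #|vpairs V| * (M * M).-1 * (k * k.-1) * #|k_edge_sets V k|.
Proof.
move=> k1; rewrite card_k_edge_sets -card_vpairs; set N := #|vpairs V|.
rewrite -big_distrl /= (double_count _ _ (fun z (E : {set {set V}}) => (z.1 \in E) && (z.2 \in E))).
have le z : z \in colliding_pairs ->
    #|[set E in k_edge_sets V k | (z.1 \in E) && (z.2 \in E)]| <= 'C(N.-2, k.-2).
  case: z => f f'; rewrite !in_set /= => /andP[/andP[fV ff'] /and3P[fV' _ _]].
  rewrite -!subn2; have <- : #|[set f; f']| = 2 by rewrite cards2 ff'.
  apply: leq_trans (card_supersets _ _); last first.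
    by rewrite subUset !sub1set !inE fV.
  by apply: subset_leq_card; apply/subsetP => E; rewrite !in_set subUset !sub1set.
apply: (@leq_trans (#|colliding_pairs| * 'C(N.-2, k.-2) * (N * N.-1))).
  by rewrite leq_mul2r -sum_nat_const leq_sum ?orbT.
rewrite -mulnA.
have -> : 'C(N.-2, k.-2) * (N * N.-1) = k * k.-1 * 'C(N, k).
  case: k k1 le => [|[|k]] // _ _.
  rewrite mulnC -mulnA (mul_bin_diag N.-1) mulnCA (mul_bin_diag N) /=.
  by rewrite mulnA [k.+1 * _]mulnC.
by rewrite -[X in _ <= X]mulnA leq_mul2r card_colliding_pairs orbT.
Qed.

(** Markov's inequality: as [M.-1 <= K n / k], the expected numbers of loops and of parallel pairs
    are at most [4K] and [24K^2], independently of [k]. *)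
Lemma few_defects k K : 1 < k -> k <= 'C(#|V|, 2) -> M.-1 * k <= K * #|V| ->
  #|[set E in k_edge_sets V k | k <= 2 * defects E]| * k
    <= 2 * (4 * K + 24 * K ^ 2) * #|k_edge_sets V k|.
Proof.
move=> k1 kN MK.
have V0 : 1 < #|V| by rewrite ltnNge; apply: contraTN kN => le; rewrite bin_small // -ltnNge; lia.
have N2 : 2 * #|vpairs V| = #|V| * #|V|.-1.
  by rewrite card_vpairs bin2 mul2n halfK; case: #|V| => // m; rewrite oddM /=; case: odd; rewrite ?subn0.
have Nk : k <= #|vpairs V| by rewrite card_vpairs.
have SW := sum_inner_pairs (ltnW k1); have SZ := sum_colliding_pairs k1.
rewrite -!big_distrl /= in SW SZ.
set W := \sum_(E in _) _ in SW; set Z := \sum_(E in _) _ in SZ.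
apply: (@leq_trans (2 * (W + Z))).
  rewrite /W /Z -big_split /= -sum_nat_const big_distrr /=.
  rewrite big_mkcond [X in _ <= X]big_mkcond /=; apply: leq_sum => E _.
  by rewrite !inE; case: ifP => [/andP[-> //]|_]; case: ifP.
rewrite -mulnA leq_mul2l /= mulnDl; move: SW SZ.
move: MK V0 N2 Nk; set n := #|V|; set N := #|vpairs V|; set O := #|k_edge_sets V k|.
move=> MK n1 N2 Nk SW SZ.
have nN : n * n <= 4 * N by nia.
apply: leq_add.
  have N0 : 0 < N by lia.
  rewrite -(leq_pmul2r N0); apply: leq_trans SW _.
  apply: (@leq_trans (K * (n * n) * O)); last by nia.
  by rewrite leq_mul2r; apply/orP; right; nia.
have N0 : 0 < N * N.-1 by nia.
rewrite -(leq_pmul2r N0); apply: leq_trans SZ _.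
(* Both sides vanish for [M <= 1]; otherwise [M + 1 <= 3 (M - 1)]. *)
have MM : (M * M).-1 <= 3 * (M.-1 * M.-1) by nia.
have step1 : (M * M).-1 * (k * k.-1) <= 3 * (K * n) ^ 2.
  apply: (@leq_trans (3 * (M.-1 * M.-1) * (k * k))); first by apply: leq_mul => //; nia.
  have := leq_mul MK MK; rewrite expnS expn1; nia.
have step2 : (M * M).-1 * (k * k.-1) <= 24 * K ^ 2 * N.-1.
  apply: leq_trans step1 _; rewrite expnMn.
  have : n ^ 2 <= 8 * N.-1 by rewrite expnS expn1; lia.
  by move: (K ^ 2) (n ^ 2) => a b ?; nia.
have := leq_mul step2 (leqnn (N * O)).
by move: (M * M).-1 (k * k.-1) N.-1 (K ^ 2) => x y z w; nia.
Qed.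

End RandomQuotient.

(** * The random graph *)

Lemma connected_parts_exist (V : finType) (H : {set {set V}}) (Delta k : nat) :
  connected_graph H -> max_degree H <= Delta -> 96 <= k -> k <= 'C(#|V|, 2) ->
  exists t (p : V -> 'I_t) M, [/\ connected_parts H p,
    forall i, #|[set v | p v == i]| <= M, 48 * t <= k &
    M.-1 * k <= 96 * (Delta + 2) * #|V|].
Proof.
move=> conH degH k96 kN; have [kn|kn] := ltnP (48 * #|V|) k.
  exists #|V|, enum_rank, 1; split=> [c _ u v /enum_rank_inj->//|i||//].
    rewrite (_ : [set v | _] = [set enum_val i]) ?cards1 //.
    by apply/setP => v; rewrite !inE -(can2_eq enum_rankK enum_valK) ?enum_valK.
  exact: ltnW.
have n1 : 1 < #|V| by rewrite ltnNge; apply: contraTN kN => le; rewrite bin_small // -ltnNge; lia.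
(* This is the least [s] with [s * k > 48n], so [t * s <= n] forces [48t < k]. Also
   [s * k <= 48n + k <= 96n], which with [k >= 96] gives [s <= n]. *)
set n := #|V| in kn n1 *; pose s := (48 * n %/ k).+1.
have sk : 48 * n < s * k by rewrite -ltn_divLR //; lia.
have ks : s * k <= 96 * n by rewrite mulSn; have := leq_trunc_div (48 * n) k; lia.
have sn : s <= n by nia.
have r_sym : symmetric (adj H) by move=> u v; rewrite /adj /= eq_sym setUC.
have r_deg v : #|adj H v| <= Delta by apply: leq_trans degH; apply: leq_bigmax.
have [||t [p [pt ts pf]]] := @connected_partition V (adj H) Delta r_sym r_deg s setT isT.
- by rewrite cardsT.
- move=> c cH u v _ _; have /connectP[q qq ->] := conH u v.
  elim: q u qq => //= w q IH u /andP[uw /IH <-].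
  by apply: cH; rewrite ?inE.
exists t, (fun v => Ordinal (pt v (in_setT v))), ((Delta + 2) * s); split.
- move=> c cH u v /(congr1 val) /= puv.
  have [_ con] := pf (p u); apply: con; rewrite ?inE ?puv ?eqxx //.
  move=> x y; rewrite !inE /= => /eqP px /eqP py xy; apply: cH => //.
  by apply/val_inj; rewrite /= px py.
- move=> i; have [le _] := pf i; apply: leq_trans le.
  by apply: subset_leq_card; apply/subsetP => v; rewrite !inE.
- by rewrite cardsT -/n in ts; nia.
- apply: (@leq_trans ((Delta + 2) * (s * k))).
    by rewrite mulnA leq_mul2r leq_pred orbT.
  by rewrite [96 * _]mulnC -mulnA leq_mul2l ks orbT.
Qed.

(** More than half of [E] survives as distinct links, so [#|E| / 2 < 12 genus + 12 #|T|]; since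
    [12 #|T| <= #|E| / 4], the genus is more than [#|E| / 48]. *)
Lemma genus_quotient_lower (V T : finType) (H E : {set {set V}}) (p : V -> T) :
  connected_parts H p -> 48 * #|T| <= #|E| -> E \subset vpairs V ->
  2 * defects p E < #|E| -> #|E| <= 48 * genus (H :|: E).
Proof.
move=> con tk EV def.
have [f fE] : exists f, f \in E by apply/card_gt0P; lia.
have [v0 _] : exists v0, v0 \in f.
  by apply/card_gt0P; move: (subsetP EV f fE); rewrite inE => /eqP->.
have con' : connected_parts (H :|: E) p.
  move=> c cH; apply: con => u v uv; apply: cH.
  by move: uv; rewrite /adj /= !inE => /andP[-> ->].
have := genus_contraction v0 con'; set Z := [set z | _] => gen.
have img := card_quotient_edges p EV; set I := [set p @: _ | _ in _] in img.
have IZ : #|I| <= #|Z|.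
  apply: (@leq_trans #|[set [set z.1; z.2] | z in Z]|); last exact: leq_imset_card.
  apply/subset_leq_card/subsetP => X /imsetP[g]; rewrite in_setD => /andP[gi gE ->] {X}.
  have gV := subsetP EV g gE.
  move: (gV); rewrite in_set => /cards2P[u [v [uv guv]]].
  have puv : p u != p v.
    move: gi; rewrite in_set gV /= negbK guv imsetU1 imset_set1 cards2.
    by case: (p u == p v).
  apply/imsetP; exists (p u, p v); last by rewrite guv imsetU1 imset_set1.
  rewrite in_set puv; apply/existsP; exists u; apply/existsP; exists v.
  by rewrite !eqxx /adj /= uv -guv inE gE orbT.
move: (genus _) #|E| #|I| #|Z| #|T| (defects p E) def tk gen img IZ; lia.
Qed.

(** Outside the event of [few_defects], [genus_quotient_lower] gives [k <= 48 genus]; the constant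
    depends on [Delta] alone. *)
Lemma genus_random_lower (Delta : nat) : exists K, forall (V : finType)
    (H : {set {set V}}) k,
  connected_graph H -> max_degree H <= Delta -> 96 <= k -> k <= 'C(#|V|, 2) ->
  #|[set E in k_edge_sets V k | 48 * genus (H :|: E) < k]| * k
    <= K * #|k_edge_sets V k|.
Proof.
set K := 96 * (Delta + 2); exists (2 * (4 * K + 24 * K ^ 2)) => V H k conH degH k96 kN.
have [t [p [M [con fib tk MK]]]] := connected_parts_exist conH degH k96 kN.
have k1 : 1 < k by lia.
apply: leq_trans (few_defects fib k1 kN MK); rewrite leq_mul2r; apply/orP; right.
apply/subset_leq_card/subsetP => E; rewrite in_set => /andP[EO gE].
rewrite in_set EO /= leqNgt; apply: contraTN gE => def.
move: EO; rewrite in_set => /andP[EV /eqP Ek]; rewrite -leqNgt.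
by have := @genus_quotient_lower V _ H E p con; rewrite card_ord Ek; apply.
Qed.

From mathcomp Require Import all_order all_algebra all_classical all_reals topology normedtype.
Import Order.TTheory GRing.Theory Num.Theory.
Import numFieldNormedType.Exports.
Local Open Scope classical_set_scope.
Local Open Scope ring_scope.

Theorem theorem1p4 (R : realType) (Delta : nat) (V : nat -> finType)
    (H : forall n, {set {set V n}}) (k : nat -> nat)
    (cardV : forall n, #|V n| = n)
    (graphH : forall n, simple_graph (H n))
    (connH : forall n, connected_graph (H n))
    (degH : forall n, (max_degree (H n) <= Delta)%N)
    (k_le : forall n, (k n <= 'C(n, 2))%N)
    (k_oo : k n @[n --> \oo] --> \oo) :
  Theta_whp R (fun n => k_edge_sets (V n) (k n))
    (fun n E => genus (H n :|: E)%SET)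
    (fun n => maxn (genus (H n)) (k n)).
Proof.
have [K HK] := genus_random_lower Delta.
(* The 48 comes from the bound by [k n], the bound by [genus (H n)] being monotonicity; the 2 from
   replacing a sum by twice the maximum. *)
exists 48^-1, 2; split; first by rewrite invr_gt0 ltr0n.
apply/cvgrPdist_lt => eps eps0.
(* The 96 is the threshold of [genus_random_lower]; the other term ensures [K < eps * k n]. *)
pose N := maxn 96 (Num.bound (K%:R / eps)).
have : \forall n \near \oo, (N <= k n)%N by exact: (k_oo _ (nbhs_infty_ge N)).
apply: filterS => n; rewrite geq_max => /andP[k96 kN].
set O := k_edge_sets (V n) (k n); set P := fun E => _.
have O0 : (0 < #|O|)%N by rewrite card_k_edge_sets cardV bin_gt0.
(* Outside [bad] both inequalities of [P] hold. *)
pose bad := [set E in O | 48 * genus (H n :|: E) < k n]%N%SET.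
have good : (#|O| <= #|[set E in O | P E]%SET| + #|bad|)%N.
  rewrite -(cardsID bad O) addnC leq_add //; last exact/subset_leq_card/finset.subsetIr.
  apply: subset_leq_card; apply/fintype.subsetP => E.
  rewrite finset.in_setD !finset.in_set => /andP[nbad /andP[EV /eqP Ek]].
  rewrite EV Ek eqxx /=; move: nbad; rewrite EV Ek eqxx /= -leqNgt => kE.
  have gH : (genus (H n) <= genus (H n :|: E)%SET)%N by apply/genus_subset/finset.subsetUl.
  have gU : (genus (H n :|: E)%SET <= genus (H n) + k n)%N.
    by rewrite -Ek; apply: genus_add_edges.
  rewrite /P mulrC ler_pdivrMr ?ltr0n // -!natrM !ler_nat.
  by apply/andP; split; lia.
have le1 : (#|[set E in O | P E]%SET| <= #|O|)%N.
  by apply: subset_leq_card; apply/fintype.subsetP => E; rewrite finset.in_set => /andP[].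
have k0 : (0 < k n)%N by apply: leq_trans k96.
have bd := HK (V n) (H n) (k n) (connH n) (degH n) k96 _.
rewrite cardV in bd; move/(_ (k_le n)): bd; rewrite -/O -/bad => bd.
rewrite /unif_prob ger0_norm; last first.
  by rewrite subr_ge0 ler_pdivrMr ?ltr0n // mul1r ler_nat.
(* The distance to 1 is below [eps] once [#|bad| < eps * #|O|]; multiplying by [k n] and using [bd]
   reduces this to [K < eps * k n]. *)
rewrite ltrBlDr -ltrBlDl ltr_pdivlMr ?ltr0n // mulrBl mul1r ltrBlDr.
apply: (@le_lt_trans _ _ (#|[set E in O | P E]%SET| + #|bad|)%:R); first by rewrite ler_nat.
rewrite natrD ltrD2l -(ltr_pM2r (x := (k n)%:R)) ?ltr0n // -natrM.
apply: (@le_lt_trans _ _ (K * #|O|)%:R); first by rewrite ler_nat.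
rewrite natrM mulrAC ltr_pM2r ?ltr0n // -ltr_pdivrMl // mulrC.
apply: lt_le_trans (_ : (Num.bound (K%:R / eps))%:R <= _); last by rewrite ler_nat.
by apply: archi_boundP; rewrite divr_ge0 ?ler0n // ltW.
Qed.
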